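(* Let $\mathcal{H}$ be a complex Hilbert space and let $A,B,X,Y\in\mathcal{B}(\mathcal{H})$. Then, for each choice of the sign $\pm$, $$ w(AXB\pm BYA)\leq 2\sqrt{2}\,\|B\|\max\{\|X\|,\|Y\|\}\sqrt{w^2(A)-\frac{\big|\,\|\Re(A)+\Im(A)\|^2-\|\Re(A)-\Im(A)\|^2\,\big|}{4}}. $$
   Context: $\mathcal{B}(\mathcal{H})$ denotes the $C^*$-algebra of bounded linear operators on the complex Hilbert space $\mathcal{H}$, with operator norm $\|\cdot\|$. For $A\in\mathcal{B}(\mathcal{H})$ with adjoint $A^*$: $\Re(A)=\frac{1}{2}(A+A^* )$ and $\Im(A)=\frac{1}{2\mathrm{i}}(A-A^* )$ (self-adjoint operators). The numerical radius is $w(A)=\sup\{|\langle Ax,x\rangle|: x\in\mathcal{H},\ \|x\|=1\}$, and $w^2(A)=(w(A))^2$. *)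

(* Defs.v *)
From HB Require Import structures.
From mathcomp Require Import all_boot all_order all_algebra sesquilinear.
From mathcomp Require Import complex.
From mathcomp Require Import all_classical all_reals all_analysis.

Set Implicit Arguments.
Unset Strict Implicit.
Unset Printing Implicit Defensive.

Import Order.TTheory GRing.Theory Num.Theory.
Import numFieldNormedType.Exports.

Local Open Scope classical_set_scope.
Local Open Scope ring_scope.

(* The base field of the normed module is R[i], so that completeness, the norm
   and its topology are those of MathComp-Analysis. The form [inner] is linear
   in its first argument and conjugate-linear in the second. *)
HB.mixin Record CompleteNormedModule_isHilbert (R : realType) H
    & CompleteNormedModule R[i] H := {
  inner : {dot H for @Num.conj R[i]} ;
  normr_inner : forall x : H, `|x| ^+ 2 = inner x x
}.

#[short(type="hilbertType")]
HB.structure Definition Hilbert (R : realType) :=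
  {H of CompleteNormedModule R[i] H & CompleteNormedModule_isHilbert R H}.

Section Operators.
Context {R : realType} {H : hilbertType R}.
Implicit Types f : H -> H.

(* For a linear map, boundedness near 0 is boundedness of the operator:
   see [linear_boundedP]. *)
Definition bounded_op f : Prop := bounded_near f (nbhs (0 : H)).

(* Norms over R[i] take values in R[i]; [realnorm] is the same norm in R. *)
Definition realnorm (V : normedZmodType R[i]) (x : V) : R := complex.Re `|x|.

Definition opnorm f : R := sup [set realnorm (f x) | x in [set x | `|x| <= 1]].

(* If H is the zero space the set is empty and [sup] is 0. *)
Definition numradius f : R :=
  sup [set realnorm (inner (f x) x) | x in [set x | `|x| = 1]].

(* Every bounded operator has exactly one adjoint (Riesz); [get] selects it,
   and only returns a default value for maps having no adjoint. *)
Definition adjoint f : H -> H :=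
  get [set g : H -> H | forall x y, inner (f x) y = inner x (g y)].

Definition Re_op f : H -> H := (2^-1 : R[i]) *: (f + adjoint f).
Definition Im_op f : H -> H := (2 * 'i : R[i])^-1 *: (f - adjoint f).

End Operators.

(* Main.v *)
(* Cauchy-Schwarz gives, for a unit vector x,
     |<(AXB +- BYA) x, x>| <= |B| max(|X|, |Y|) (|A x| + |A^* x|),
   so it suffices to bound |A x|^2 + |A^* x|^2. The parallelogram law turns it
   into |(Re A + Im A) x|^2 + |(Re A - Im A) x|^2 <= a + b, where a and b are
   the squared norms of Re A + Im A and Re A - Im A. Both operators have the
   form c A + c^* A^* with |c|^2 = 1/2; being self-adjoint, their norms are
   those of their quadratic forms x |-> 2 Re (c <A x, x>), so a, b <= 2 w(A)^2
   and a + b = 2 max(a, b) - |a - b| <= 4 (w(A)^2 - |a - b| / 4).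
   The adjoint itself is obtained from the Riesz representation theorem, the
   representing vector of phi being the minimizer of |x|^2 - 2 Re (phi x). *)

Require Import Defs.
From HB Require Import structures.
From mathcomp Require Import all_boot all_order all_algebra sesquilinear.
From mathcomp Require Import complex.
From mathcomp Require Import ring lra.
From mathcomp Require Import all_classical all_reals all_analysis.

Set Implicit Arguments.
Unset Strict Implicit.
Unset Printing Implicit Defensive.

Import Order.TTheory GRing.Theory Num.Theory.
Import numFieldNormedType.Exports.

Local Open Scope classical_set_scope.
Local Open Scope ring_scope.
Local Open Scope complex_scope.

(** * Real-valued norm, real inner product and the Cauchy-Schwarz inequality *)

Section Hilbert.
Context {R : realType} {H : hilbertType R}.
Implicit Types (x y z : H) (c d : R[i]) (t : R).

Lemma realnormE {V : normedZmodType R[i]} (x : V) : `|x| = (realnorm x)%:C.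
Proof. by rewrite /realnorm RRe_real // ger0_real. Qed.

Lemma realnorm_ge0 {V : normedZmodType R[i]} (x : V) : 0 <= realnorm x.
Proof. by rewrite -lecR -realnormE; exact: normr_ge0. Qed.

Lemma realnormD {V : normedZmodType R[i]} (x y : V) :
  realnorm (x + y) <= realnorm x + realnorm y.
Proof. by rewrite -lecR rmorphD /= -!realnormE ler_normD. Qed.

Lemma realnormN {V : normedZmodType R[i]} (x : V) :
  realnorm (- x) = realnorm x.
Proof. by rewrite /realnorm normrN. Qed.

Lemma realnormZ c x : realnorm (c *: x) = realnorm c * realnorm x.
Proof. by apply: complexI; rewrite rmorphM /= -!realnormE normrZ. Qed.

Lemma realnormM c d : realnorm (c * d) = realnorm c * realnorm d.
Proof. by apply: complexI; rewrite rmorphM /= -!realnormE normrM. Qed.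

Lemma realnorm_conj c : realnorm (c^*%C) = realnorm c.
Proof. by rewrite /realnorm normcJ. Qed.

Lemma realnorm_eq0 x : realnorm x = 0 -> x = 0.
Proof. by move=> x0; apply: normr0_eq0; rewrite realnormE x0. Qed.

Lemma sqr_realnorm c :
  realnorm c ^+ 2 = complex.Re c ^+ 2 + complex.Im c ^+ 2.
Proof. by apply: complexI; rewrite add_Re2_Im2 rmorphXn /= -realnormE. Qed.

Lemma realnorm_real t : realnorm (t%:C) = `|t|.
Proof.
apply/eqP; rewrite -(@eqrXn2 _ 2) ?realnorm_ge0 //.
by rewrite sqr_realnorm /= expr0n /= addr0 real_normK // num_real.
Qed.

Lemma normr_Re_le c : `|complex.Re c| <= realnorm c.
Proof. by rewrite -lecR -realnormE normc_ge_Re. Qed.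

Lemma innerC x y : inner x y = (inner y x)^*%C.
Proof. by rewrite (hermC inner) expr0 mul1r. Qed.

Lemma innerZl c x y : inner (c *: x) y = c * inner x y.
Proof. by rewrite linearZl_LR. Qed.

Lemma innerZr c x y : inner x (c *: y) = c^*%C * inner x y.
Proof. by rewrite linearZr_LR. Qed.

(** The real part makes H a real inner product space with the same norm, so that quadratic
    expansions become ordered-field arithmetic in [R]. *)
Definition rinner x y : R := complex.Re (inner x y).

Lemma rinnerC x y : rinner x y = rinner y x.
Proof. by rewrite /rinner innerC; case: (inner y x). Qed.

Lemma rinnerDl x y z : rinner (x + y) z = rinner x z + rinner y z.
Proof. by rewrite /rinner linearDl raddfD. Qed.

Lemma rinnerDr x y z : rinner x (y + z) = rinner x y + rinner x z.
Proof. by rewrite /rinner linearDr raddfD. Qed.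

Lemma rinnerZl t x y : rinner (t%:C *: x) y = t * rinner x y.
Proof. by rewrite /rinner innerZl; case: (inner x y) => a b; simpc. Qed.

Lemma rinnerZr t x y : rinner x (t%:C *: y) = t * rinner x y.
Proof. by rewrite rinnerC rinnerZl rinnerC. Qed.

Lemma rinnerNl x y : rinner (- x) y = - rinner x y.
Proof. by rewrite /rinner linearNl raddfN. Qed.

Lemma rinnerNr x y : rinner x (- y) = - rinner x y.
Proof. by rewrite rinnerC rinnerNl rinnerC. Qed.

Definition rinnerE := (rinnerDl, rinnerDr, rinnerNl, rinnerNr, rinnerZl, rinnerZr).

Lemma rinnerxx x : rinner x x = realnorm x ^+ 2.
Proof. by rewrite /rinner -normr_inner realnormE -rmorphXn. Qed.

(** With a = |x| and b = |y|, expanding |b x - a y|^2 >= 0 gives 2ab (ab - Re <x, y>) >= 0; divide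
    by ab. *)
Lemma rinner_le x y : rinner x y <= realnorm x * realnorm y.
Proof.
have [x0|x0] := eqVneq (realnorm x) 0.
  by rewrite x0 mul0r (realnorm_eq0 x0) /rinner linear0l.
have [y0|y0] := eqVneq (realnorm y) 0.
  by rewrite y0 mulr0 (realnorm_eq0 y0) /rinner linear0r.
have := sqr_ge0 (realnorm ((realnorm y)%:C *: x - (realnorm x)%:C *: y)).
rewrite -rinnerxx !rinnerE !rinnerxx (rinnerC y x).
set a := realnorm x; set b := realnorm y.
have a0 : 0 < a by rewrite lt_neqAle eq_sym x0 realnorm_ge0.
have b0 : 0 < b by rewrite lt_neqAle eq_sym y0 realnorm_ge0.
have ab0 : 0 < a * b by rewrite mulr_gt0.
by set r := rinner _ _ => h; rewrite -(ler_pM2l ab0); lra.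
Qed.

(** Multiplying x by the conjugate of z = <x, y> turns the inner product into the real number |z|^2,
    so the real inequality applies and a factor |z| cancels. *)
Lemma realnorm_inner_le x y : realnorm (inner x y) <= realnorm x * realnorm y.
Proof.
set z := inner x y.
have [z0|z0] := eqVneq (realnorm z) 0.
  by rewrite z0 mulr_ge0 // realnorm_ge0.
have {}z0 : 0 < realnorm z by rewrite lt_neqAle eq_sym z0 realnorm_ge0.
have := rinner_le (z^*%C *: x) y.
rewrite realnormZ realnorm_conj -mulrA /rinner innerZl -/z.
have -> : complex.Re (z^*%C * z) = realnorm z * realnorm z.
  by rewrite -expr2 sqr_realnorm; case: (z) => a b /=; ring.
by rewrite ler_pM2l.
Qed.

Lemma inner_eqP x y : (forall z, rinner z x = rinner z y) -> x = y.
Proof.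
move=> xy; apply/eqP; rewrite -subr_eq0; apply/eqP/realnorm_eq0/eqP.
by rewrite -sqrf_eq0 -rinnerxx rinnerDr rinnerNr xy subrr.
Qed.
End Hilbert.

(** * Riesz representation of a bounded real-linear functional *)

Section Riesz.
Context {R : realType} {H : hilbertType R}.
Implicit Types (x y z : H) (t : R).

Lemma poly2_ge0_eq0 (a D : R) :
  0 <= a -> (forall t, 0 <= t ^+ 2 * a + 2 * t * D) -> D = 0.
Proof.
(* The minimizer would be t = -D / a; the denominator a + 1 also covers a = 0. *)
move=> a0 /(_ (- D / (a + 1))) h.
have a1 : 0 < a + 1 by lra.
have : 0 <= (a + 1) ^+ 2 * ((- D / (a + 1)) ^+ 2 * a + 2 * (- D / (a + 1)) * D).
  by rewrite mulr_ge0 // sqr_ge0.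
have -> : (a + 1) ^+ 2 * ((- D / (a + 1)) ^+ 2 * a + 2 * (- D / (a + 1)) * D)
  = - (D ^+ 2 * (a + 2)) by field; rewrite gt_eqF.
rewrite oppr_ge0 => h'; apply/eqP; rewrite -sqrf_eq0 eq_le sqr_ge0 andbT.
by rewrite -(pmulr_lle0 _ (_ : 0 < a + 2)) //; lra.
Qed.

Variables (phi : H -> R) (M : R).
Hypothesis phiD : forall x y, phi (x + y) = phi x + phi y.
Hypothesis phiZ : forall t x, phi (t%:C *: x) = t * phi x.
Hypothesis phi_le : forall x, phi x <= M * realnorm x.

(** If z represents [phi], then F x = |x - z|^2 - |z|^2, so z is the unique minimizer. *)
Let F x := realnorm x ^+ 2 - 2 * phi x.

Let F_lb x : - M ^+ 2 <= F x.
Proof. by have := phi_le x; have := sqr_ge0 (realnorm x - M); rewrite /F; lra. Qed.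

Let m := inf [set F x | x in setT].

Let m_le x : m <= F x.
Proof.
apply: ge_inf; last by exists x.
by exists (- M ^+ 2) => _ [y _ <-].
Qed.

Let B e := [set x | F x < m + e].

Let B_nonempty e : 0 < e -> B e !=set0.
Proof.
move=> e0; have : has_inf [set F x | x in setT].
  split; first by exists (F 0), 0.
  by exists (- M ^+ 2) => _ [y _ <-].
move=> /(inf_adherent e0) [_ [x _ <-] Fx].
by exists x.
Qed.

(* Parallelogram law: F x + F y = 2 F ((x + y) / 2) + |x - y|^2 / 2. *)
Let B_close e x y : B e x -> B e y -> realnorm (x - y) ^+ 2 < 4 * e.
Proof.
rewrite /B /= => Bx By; have := m_le ((2^-1)%:C *: (x + y)).
move: Bx By; rewrite /F phiZ phiD -!rinnerxx !rinnerE (rinnerC y x).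
by lra.
Qed.

(** The filter generated by the sets of near-minimizers plays the part of a minimizing sequence. *)
Let G := filter_from [set e : R | 0 < e] B.

#[local] Instance G_filter : ProperFilter G.
Proof.
apply: filter_from_proper; last by move=> e /B_nonempty.
apply: filter_from_filter; first by exists 1 => /=.
move=> e e' /= e0 e'0; exists (Num.min e e') => /=; first by rewrite lt_min e0.
by move=> x; rewrite /B /= => Bx; split; apply: lt_le_trans Bx _;
  rewrite lerD2l ge_min lexx ?orbT.
Qed.

Let ball_realnorm x y (e : R) : 0 < e -> ball x (e%:C) y <-> realnorm (x - y) < e.
Proof. by move=> e0; rewrite -ball_normE /ball_ /= realnormE ltcR. Qed.

(** Balls of H have radii in [R[i]], where positive elements are real. *)
Let pos_real (e : R[i]) : 0 < e -> exists2 t : R, 0 < t & e = t%:C.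
Proof.
move=> e0; exists (complex.Re e); last by rewrite RRe_real // gtr0_real.
by rewrite -ltcR RRe_real // gtr0_real.
Qed.

Let G_cvg : cvg G.
Proof.
apply/cauchy_cvgP/cauchy_exP => _ /pos_real[e e0 ->].
(* Chosen so that [B_close] yields |x - y|^2 < e^2. *)
have d0 : 0 < e ^+ 2 / 4 by rewrite divr_gt0 // exprn_gt0.
have [x Bx] := B_nonempty d0; exists x; exists (e ^+ 2 / 4) => //= y By.
apply/ball_realnorm => //; have := B_close Bx By.
rewrite [X in _ < X](_ : _ = e ^+ 2); last by field.
by rewrite ltr_pXn2r // nnegrE ?realnorm_ge0 // ltW.
Qed.

(** At the limit z, the first variation of [F] in a direction h vanishes: 0 <= t^2 |h|^2 + 2 t (Re
    <h, z> - phi h) for all t. This is obtained up to an arbitrary e from a near-minimizer y close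
    to z. *)
Lemma riesz : exists z, forall x, phi x = rinner x z.
Proof.
exists (lim G) => h; set z := lim G.
have near_z (e : R) : 0 < e -> exists2 y, F y < m + e & realnorm (z - y) < e.
  move=> e0; have Ge : G (B e) by exists e.
  have Gz : G (ball z (e%:C)).
    by apply: G_cvg; apply: nbhsx_ballx; rewrite ltcR.
  have [y [By zy]] := filter_ex (filterI Ge Gz).
  by exists y => //; apply/ball_realnorm.
apply/esym/eqP; rewrite -subr_eq0; apply/eqP.
apply: (@poly2_ge0_eq0 (realnorm h ^+ 2)) => [|t]; first exact: sqr_ge0.
set D := _ - _; apply/ler_addgt0Pr => e e0.
set n := realnorm h; have n0 : 0 <= n by exact: realnorm_ge0.
(* The error e splits into e / k, from F y < m + e / k, and 2 |t| n e / k, from replacing y by z in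
   the inner product with h. *)
set k := 1 + 2 * `|t| * n.
have k0 : 0 < k by rewrite /k; have := mulr_ge0 (normr_ge0 t) n0; lra.
have [y Fy zy] := near_z _ (divr_gt0 e0 k0).
have tle : t * rinner h (y - z) <= `|t| * (n * (e / k)).
  have -> : t * rinner h (y - z) = rinner (t%:C *: h) (y - z) by rewrite rinnerZl.
  apply: le_trans (rinner_le _ _) _.
  rewrite realnormZ realnorm_real -mulrA ler_wpM2l // ler_wpM2l //.
  by rewrite -realnormN opprB ltW.
have := m_le (y + t%:C *: h).
have ek : e = e / k + 2 * `|t| * n * (e / k).
  by rewrite -[LHS](divfK (lt0r_neq0 k0)) /k; ring.
move: Fy tle; rewrite /F phiD phiZ -!rinnerxx !rinnerE !rinnerxx (rinnerC y h) -/n.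
rewrite /D [X in _ -> _ -> _ -> _ <= _ + X]ek; lra.
Qed.

End Riesz.

(** * Bounds for the operator norm and the numerical radius *)

Section OperatorNorms.
Context {R : realType} {H : hilbertType R}.
Implicit Types (x : H) (t : R) (f : H -> H).

Definition norm_bound f (M : R) := forall x, realnorm (f x) <= M * realnorm x.

Lemma bounded_op_bound (f : {linear H -> H}) :
  bounded_op f -> exists M, norm_bound f M.
Proof.
move=> /linear_boundedP /pinfty_ex_gt0[r r0 fr]; exists (complex.Re r) => x.
by rewrite -lecR rmorphM /= -!realnormE RRe_real // gtr0_real.
Qed.

Lemma sup_nonneg (E : set R) : (forall t, E t -> 0 <= t) -> 0 <= sup E.
Proof.
(* Without a supremum, [sup] takes the default value 0. *)
move=> E0; have [[[t Et] Eub]|/sup_out->//] := pselect (has_sup E).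
by apply: le_trans (E0 _ Et) _; exact: ub_le_sup.
Qed.

Lemma opnorm_ge0 f : 0 <= opnorm f.
Proof. by apply: sup_nonneg => _ [x _ <-]; exact: realnorm_ge0. Qed.

Lemma numradius_ge0 f : 0 <= numradius f.
Proof. by apply: sup_nonneg => _ [x _ <-]; exact: realnorm_ge0. Qed.

Lemma opnorm_unit_le f M x :
  norm_bound f M -> realnorm x <= 1 -> realnorm (f x) <= opnorm f.
Proof.
move=> fM x1; apply: ub_le_sup; last by exists x; rewrite //= realnormE lecR.
(* The sign of [M] is unknown, hence the absolute value. *)
exists `|M| => _ [y /= y1 <-]; apply: le_trans (fM y) _.
rewrite realnormE lecR in y1.
apply: (@le_trans _ _ (`|M| * realnorm y)).
  by rewrite ler_wpM2r ?realnorm_ge0 ?ler_norm.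
by rewrite ler_piMr.
Qed.

Lemma opnorm_le f (k : R) :
  (forall x, realnorm x <= 1 -> realnorm (f x) <= k) -> opnorm f <= k.
Proof.
move=> fk; apply: ge_sup; first by exists (realnorm (f 0)), 0; rewrite //= normr0.
by move=> _ [x /= x1 <-]; apply: fk; rewrite realnormE lecR in x1.
Qed.

(** The condition 0 <= k handles the zero space, which has no unit vector and where the supremum is
    0. *)
Lemma numradius_le f (k : R) : 0 <= k ->
  (forall x, realnorm x = 1 -> realnorm (inner (f x) x) <= k) ->
  numradius f <= k.
Proof.
move=> k0 fk; rewrite /numradius; set E := [set _ | _ in _].
have [[t Et]|/set0P/negP/negPn/eqP->] := pselect (E !=set0); last by rewrite sup0.
apply: ge_sup; first by exists t.
by move=> _ [x /= x1 <-]; apply: fk; rewrite /realnorm x1.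
Qed.

Lemma polar_decomposition x : realnorm x != 0 ->
  exists2 u, realnorm u = 1 & x = (realnorm x)%:C *: u.
Proof.
move=> x0; exists ((realnorm x)^-1%:C *: x).
  by rewrite realnormZ realnorm_real ger0_norm ?invr_ge0 ?realnorm_ge0 ?mulVf.
by rewrite scalerA -rmorphM mulfV // scale1r.
Qed.

Lemma le_opnorm (f : {linear H -> H}) x :
  bounded_op f -> realnorm (f x) <= opnorm f * realnorm x.
Proof.
move=> /bounded_op_bound[M fM].
have [x0|x0] := eqVneq (realnorm x) 0.
  by rewrite (realnorm_eq0 x0) linear0 {1}/realnorm normr0 mulr_ge0 ?opnorm_ge0 ?realnorm_ge0.
have [u u1] := polar_decomposition x0.
have := realnorm_ge0 x; move: (realnorm x) => r r0 ->.
rewrite linearZ realnormZ realnorm_real ger0_norm // mulrC ler_wpM2r //.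
by apply: (opnorm_unit_le fM); rewrite u1.
Qed.

Lemma le_numradius (f : {linear H -> H}) x :
  bounded_op f -> realnorm (inner (f x) x) <= numradius f * realnorm x ^+ 2.
Proof.
move=> /bounded_op_bound[M fM].
have [x0|x0] := eqVneq (realnorm x) 0.
  rewrite (realnorm_eq0 x0) linear0 {1}/realnorm normr0.
  by rewrite mulr_ge0 ?numradius_ge0 ?sqr_ge0.
have [u u1] := polar_decomposition x0.
have := realnorm_ge0 x; move: (realnorm x) => r r0 ->.
rewrite (linearZ_LR f) /= innerZl innerZr mulrA realnormM mulrC.
apply: ler_pM; rewrite ?realnorm_ge0 //; last first.
  by rewrite realnormM realnorm_conj realnorm_real ger0_norm.
apply: ub_le_sup; last by exists u; rewrite //= realnormE u1.
exists M => _ [y /= y1 <-]; apply: (le_trans (realnorm_inner_le _ _)).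
have {}y1 : realnorm y = 1 by rewrite /realnorm y1.
by have := fM y; rewrite y1 !mulr1.
Qed.

End OperatorNorms.

(** * Existence and real-linearity of the adjoint *)

Section Adjoint.
Context {R : realType} {H : hilbertType R}.
Implicit Types (x y z : H) (t : R).
Variable f : {linear H -> H}.
Hypothesis f_bounded : bounded_op f.

(** Once some adjoint exists, [get] returns one. For each y, Riesz applied to x |-> Re <f x, y>
    gives its value at y, and [choice] assembles these values. *)
Lemma adjointP x y : inner (f x) y = inner x (adjoint f y).
Proof.
suff: exists g : H -> H, forall x y, inner (f x) y = inner x (g y).
  by move=> /getPex; apply.
suff /choice[g fg] : forall y, exists z, forall x, inner (f x) y = inner x z.
  by exists g.
move=> {x} {}y; have [M fM] := bounded_op_bound f_bounded.
have [||x|z fz] := @riesz R H (fun x => rinner (f x) y) (M * realnorm y).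
- by move=> x x'; rewrite linearD rinnerDl.
- by move=> t x; rewrite linearZ rinnerZl.
- apply: le_trans (rinner_le _ _) _.
  by rewrite mulrAC ler_wpM2r ?realnorm_ge0.
(* The imaginary parts agree because [Re (i * c) = - Im c]. *)
exists z => x; have := fz ('i *: x); have := fz x.
rewrite /rinner linearZ !innerZl.
case: (inner (f x) y) => a b; case: (inner x z) => a' b' /=.
by rewrite !mul0r !mul1r !sub0r => -> /oppr_inj ->.
Qed.

Lemma rinner_adjoint x y : rinner (adjoint f x) y = rinner x (f y).
Proof. by rewrite rinnerC /rinner -adjointP -/(rinner _ _) rinnerC. Qed.

(** As a value of [get], [adjoint f] carries no linear structure; it is recovered by testing against
    every vector. *)
Lemma adjointD x y : adjoint f (x + y) = adjoint f x + adjoint f y.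
Proof.
by apply: inner_eqP => z; rewrite rinnerDr !(rinnerC z) !rinner_adjoint rinnerDl.
Qed.

Lemma adjointZ t x : adjoint f (t%:C *: x) = t%:C *: adjoint f x.
Proof.
by apply: inner_eqP => z; rewrite rinnerZr !(rinnerC z) !rinner_adjoint rinnerZl.
Qed.

End Adjoint.

(** * Norms of Re A + Im A and Re A - Im A *)

Section CartesianDecomposition.
Context {R : realType} {H : hilbertType R}.
Implicit Types (x y z : H) (c : R[i]) (t k : R).

Lemma parallelogram x y :
  realnorm (x + y) ^+ 2 + realnorm (x - y) ^+ 2
  = 2 * (realnorm x ^+ 2 + realnorm y ^+ 2).
Proof. by rewrite -!rinnerxx !rinnerE; ring. Qed.

(* Polarization bounds [rinner (T x) y] by [k (|x|^2 + |y|^2) / 2]; then take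
   [y] to be the multiple of [T x] whose norm is that of [x]. *)
Lemma selfadjoint_norm_bound (T : H -> H) k : 0 <= k ->
  (forall x y, T (x + y) = T x + T y) ->
  (forall t x, T (t%:C *: x) = t%:C *: T x) ->
  (forall x y, rinner (T x) y = rinner x (T y)) ->
  (forall x, `|rinner (T x) x| <= k * realnorm x ^+ 2) ->
  norm_bound T k.
Proof.
move=> k0 TD TZ Tsym Tk x; set n := realnorm x; set s := realnorm (T x).
have n0 : 0 <= n by exact: realnorm_ge0.
have [->|s0] := eqVneq s 0; first by rewrite mulr_ge0.
have T0 : T 0 = 0 by have := TZ 0 0; rewrite !scale0r.
have {}n0 : 0 < n.
  rewrite lt_neqAle n0 andbT eq_sym; apply: contra s0 => /eqP/realnorm_eq0 x0.
  by rewrite /s x0 T0 /realnorm normr0.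
have {}s0 : 0 < s by rewrite lt_neqAle eq_sym s0 realnorm_ge0.
have TN y : T (- y) = - T y.
  by have := TZ (-1) y; rewrite rmorphN1 !scaleN1r.
have polar y : 2 * rinner (T x) y <= k * (realnorm x ^+ 2 + realnorm y ^+ 2).
  have /ler_normlP[_ h1] := Tk (x + y); have /ler_normlP[h2 _] := Tk (x - y).
  have := parallelogram x y; move: h1 h2.
  rewrite !TD !TN !rinnerE (rinnerC (T y) x) -Tsym => h1 h2 par.
  have : k * (realnorm (x + y) ^+ 2 + realnorm (x - y) ^+ 2)
       = k * (2 * (realnorm x ^+ 2 + realnorm y ^+ 2)) by rewrite par.
  by lra.
have := polar ((n / s)%:C *: T x).
rewrite rinnerE rinnerxx realnormZ realnorm_real -/s -/n.
rewrite ger0_norm ?divr_ge0 ?(ltW s0) ?(ltW n0) // divfK ?gt_eqF //.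
have -> : n / s * s ^+ 2 = n * s by field; rewrite gt_eqF.
by move=> h; rewrite -(ler_pM2l n0); lra.
Qed.

Variable A : {linear H -> H}.
Hypothesis A_bounded : bounded_op A.

(** This is 2 Re (c A), a self-adjoint family containing both Re A + Im A and Re A - Im A, so one
    norm bound serves for both. *)
Definition twisted_re c x := c *: A x + c^*%C *: adjoint A x.

Lemma twisted_reD c x y :
  twisted_re c (x + y) = twisted_re c x + twisted_re c y.
Proof. by rewrite /twisted_re adjointD // linearD !scalerDr addrACA. Qed.

Lemma twisted_reZ c t x : twisted_re c (t%:C *: x) = t%:C *: twisted_re c x.
Proof.
by rewrite /twisted_re adjointZ // linearZ scalerDr !scalerA ![_ * t%:C]mulrC.
Qed.

Lemma twisted_re_sym c x y :
  rinner (twisted_re c x) y = rinner x (twisted_re c y).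
Proof.
have conj_sym z w : rinner (c^*%C *: adjoint A z) w = rinner z (c *: A w).
  rewrite rinnerC /rinner (innerZr (c^*%C)) conjcK -adjointP //.
  by rewrite -innerZl -/(rinner _ _) rinnerC.
rewrite /twisted_re rinnerDl rinnerDr conj_sym addrC; congr (_ + _).
by rewrite [RHS]rinnerC conj_sym rinnerC.
Qed.

Lemma twisted_re_quadratic c x :
  rinner (twisted_re c x) x = 2 * complex.Re (c * inner (A x) x).
Proof.
rewrite rinnerDl [rinner (_ *: adjoint A x) x]rinnerC /rinner.
rewrite (innerZr (c^*%C)) conjcK -adjointP // innerZl; ring.
Qed.

Lemma twisted_re_norm_bound c :
  norm_bound (twisted_re c) (2 * realnorm c * numradius A).
Proof.
apply: selfadjoint_norm_bound.
- by rewrite !mulr_ge0 ?realnorm_ge0 ?numradius_ge0.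
- exact: twisted_reD.
- exact: twisted_reZ.
- exact: twisted_re_sym.
move=> x; rewrite twisted_re_quadratic normrM ger0_norm // -!mulrA ler_pM2l //.
apply: le_trans (normr_Re_le _) _.
by rewrite realnormM ler_wpM2l ?realnorm_ge0 ?le_numradius.
Qed.

Lemma opnorm_twisted_re c : realnorm c ^+ 2 = 1 / 2 ->
  opnorm (twisted_re c) ^+ 2 <= 2 * numradius A ^+ 2.
Proof.
move=> c2; have -> : 2 * numradius A ^+ 2 = (2 * realnorm c * numradius A) ^+ 2.
  by rewrite !exprMn c2; field.
have k0 : 0 <= 2 * realnorm c * numradius A.
  by rewrite !mulr_ge0 ?realnorm_ge0 ?numradius_ge0.
rewrite ler_pXn2r ?nnegrE ?opnorm_ge0 //; apply: opnorm_le => x x1.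
by apply: le_trans (twisted_re_norm_bound _ _) _; rewrite ler_piMr.
Qed.

(** The coefficient of A in Re A + Im A is 1/2 + 1/(2i) = (1 - i)/2; in Re A - Im A it is the
    conjugate. *)
Let C : R[i] := Complex (2^-1) (- 2^-1).

Let C2 : realnorm C ^+ 2 = 1 / 2.
Proof. by rewrite sqr_realnorm /=; field. Qed.

Let halfE : (2^-1 : R[i]) = (2^-1)%:C.
Proof. by rewrite fmorphV rmorph_nat. Qed.

Let half_iE : (2 * 'i%R : R[i])^-1 = (- 2^-1)*i.
Proof. by rewrite invfM invCi halfE -complexiE; simpc. Qed.

Lemma Re_op_add_Im_op : Re_op A + Im_op A = twisted_re C.
Proof.
apply/funext => x; rewrite /Re_op /Im_op /twisted_re !fctE.
rewrite scalerBr scalerDr addrACA -scalerDl -scalerBl halfE half_iE.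
by congr (_ *: _ + _ *: _); rewrite /C; simpc.
Qed.

Lemma Re_op_sub_Im_op : Re_op A - Im_op A = twisted_re C^*%C.
Proof.
apply/funext => x; rewrite /Re_op /Im_op /twisted_re !fctE.
rewrite scalerBr scalerDr opprB [X in _ + X]addrC addrACA -scalerBl -scalerDl.
rewrite halfE half_iE.
by congr (_ *: _ + _ *: _); rewrite /C; simpc.
Qed.

Lemma adjoint_square_sum_le x : realnorm x = 1 ->
  realnorm (A x) ^+ 2 + realnorm (adjoint A x) ^+ 2
  <= 4 * (numradius A ^+ 2 - `| opnorm (Re_op A + Im_op A) ^+ 2
                 - opnorm (Re_op A - Im_op A) ^+ 2 | / 4).
Proof.
move=> x1; pose u := (2^-1 : R[i]) *: (A x + adjoint A x).
pose v := (2 * 'i%R : R[i])^-1 *: (A x - adjoint A x).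
(* The parallelogram law is used twice: for u and v, then for A x and A^* x, the two factors 2
   cancelling the 1/4 from the halves. *)
have pm : realnorm (A x) ^+ 2 + realnorm (adjoint A x) ^+ 2
   = realnorm (u + v) ^+ 2 + realnorm (u - v) ^+ 2.
  have n2 : realnorm (2^-1 : R[i]) ^+ 2 = 4^-1.
    by rewrite halfE sqr_realnorm /=; field.
  have ni : realnorm ((2 * 'i%R)^-1 : R[i]) ^+ 2 = 4^-1.
    by rewrite half_iE sqr_realnorm /=; field.
  rewrite parallelogram !realnormZ !exprMn n2 ni -mulrDr parallelogram.
  by field.
have sq_le (f : H -> H) c : f = twisted_re c ->
    realnorm (f x) ^+ 2 <= opnorm f ^+ 2.
  move=> fE; rewrite ler_pXn2r ?nnegrE ?opnorm_ge0 ?realnorm_ge0 //.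
  rewrite fE; apply: (opnorm_unit_le (twisted_re_norm_bound c)).
  by rewrite x1.
have up := sq_le _ _ Re_op_add_Im_op; have vp := sq_le _ _ Re_op_sub_Im_op.
have uw := opnorm_twisted_re C2.
have vw : opnorm (twisted_re C^*%C) ^+ 2 <= 2 * numradius A ^+ 2.
  by apply: opnorm_twisted_re; rewrite realnorm_conj.
rewrite pm; move: up vp uw vw; rewrite -Re_op_add_Im_op -Re_op_sub_Im_op.
rewrite !fctE -/u -/v.
(* The sign of the difference tells which square is the larger; only that one is replaced by its
   bound 2 w(A)^2. *)
by have [_|_] := ler0P (_ - _); lra.
Qed.

End CartesianDecomposition.

(** * Numerical radius of AXB + BYA and AXB - BYA *)

Section Commutator.
Context {R : realType} {H : hilbertType R}.
Variables A B X Y : {linear H -> H}.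
Hypotheses (hA : bounded_op A) (hB : bounded_op B).
Hypotheses (hX : bounded_op X) (hY : bounded_op Y).

(** In <AXB x, x> the outer A moves to the right as A^*, leaving XB x paired with A^* x; in <BYA x,
    x> the operators B and Y act on A x. *)
Lemma realnorm_inner_sandwich_le (x : H) : realnorm x = 1 ->
  realnorm (inner (A (X (B x))) x) + realnorm (inner (B (Y (A x))) x)
  <= opnorm B * Num.max (opnorm X) (opnorm Y) *
     (realnorm (A x) + realnorm (adjoint A x)).
Proof.
move=> x1; set m := Num.max _ _.
have Xm : opnorm X <= m by rewrite le_max lexx.
have Ym : opnorm Y <= m by rewrite le_max lexx orbT.
have m0 : 0 <= m := le_trans (opnorm_ge0 X) Xm.
rewrite addrC mulrDr; apply: lerD.
  apply: le_trans (realnorm_inner_le _ _) _; rewrite x1 mulr1.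
  apply: le_trans (le_opnorm _ hB) _; rewrite -mulrA ler_wpM2l ?opnorm_ge0 //.
  by apply: le_trans (le_opnorm _ hY) _; rewrite ler_wpM2r ?realnorm_ge0.
rewrite adjointP //; apply: le_trans (realnorm_inner_le _ _) _.
rewrite ler_wpM2r ?realnorm_ge0 //; apply: le_trans (le_opnorm _ hX) _.
rewrite mulrC; apply: ler_pM; rewrite ?realnorm_ge0 ?opnorm_ge0 //.
by have := le_opnorm x hB; rewrite x1 mulr1.
Qed.

(** With a = |A x|, b = |A^* x| and a^2 + b^2 <= 4Q, the constant comes from (a + b)^2 <= 2 (a^2 +
    b^2) <= 8Q. *)
Lemma realnorm_sandwich_bound (x : H) : realnorm x = 1 ->
  realnorm (inner (A (X (B x))) x) + realnorm (inner (B (Y (A x))) x)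
  <= 2 * Num.sqrt 2 * opnorm B * Num.max (opnorm X) (opnorm Y) *
    Num.sqrt (numradius A ^+ 2 -
              `| opnorm (Re_op A + Im_op A) ^+ 2
                 - opnorm (Re_op A - Im_op A) ^+ 2 | / 4).
Proof.
move=> x1; apply: le_trans (realnorm_inner_sandwich_le x1) _.
have := adjoint_square_sum_le hA x1; set Q := _ - _ / 4.
set m := Num.max _ _; set a := realnorm (A x); set b := realnorm _ => abQ.
have m0 : 0 <= m by rewrite le_max opnorm_ge0.
rewrite [leRHS](_ : _ = opnorm B * m * (2 * Num.sqrt 2 * Num.sqrt Q)); last by ring.
rewrite ler_wpM2l ?mulr_ge0 ?opnorm_ge0 //.
have [a0 b0] : 0 <= a /\ 0 <= b by rewrite !realnorm_ge0.
(* The radicand dominates a sum of squares, so squaring its root gives back [Q]. *)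
have Q0 : 0 <= Q by have := sqr_ge0 a; have := sqr_ge0 b; lra.
rewrite -(@ler_pXn2r _ 2) ?nnegrE ?addr_ge0 ?mulr_ge0 ?sqrtr_ge0 //.
rewrite !exprMn !sqr_sqrtr //.
by have := sqr_ge0 (a - b); lra.
Qed.

End Commutator.

Theorem theorem3p7 (R : realType) (H : hilbertType R) (A B X Y : {linear H -> H})
    (hA : bounded_op A) (hB : bounded_op B)
    (hX : bounded_op X) (hY : bounded_op Y) :
  let bound : R :=
    2 * Num.sqrt 2 * opnorm B * Num.max (opnorm X) (opnorm Y) *
    Num.sqrt (numradius A ^+ 2 -
              `| opnorm (Re_op A + Im_op A) ^+ 2
                 - opnorm (Re_op A - Im_op A) ^+ 2 | / 4) in
  numradius ((A \o X \o B) + (B \o Y \o A)) <= bound /\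
  numradius ((A \o X \o B) - (B \o Y \o A)) <= bound.
Proof.
move=> bound.
have bound_ge0 : 0 <= bound.
  by rewrite !mulr_ge0 ?sqrtr_ge0 ?opnorm_ge0 // le_max opnorm_ge0.
(* By the triangle inequality both signs reduce to the same sum of two moduli. *)
split; apply: numradius_le => // x x1;
    apply: le_trans (realnorm_sandwich_bound hA hB hX hY x1);
    rewrite !fctE /=.
  by rewrite linearDl realnormD.
by rewrite linearBl -[realnorm (inner (B _) x)]realnormN realnormD.
Qed.
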